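(* Let $T=(V,E)$ be an undirected tree with $V=[d]$, $d\ge 2$, and let $\lambda:E\to[r]$ be an edge coloring. Then the colored Hüsler–Reiss tree model, the Hüsler–Reiss RCON model and the Hüsler–Reiss RVAR model with respect to $(T,\lambda)$ coincide. That is, for every Hüsler–Reiss vector $\mathbf{Y}$ with parameter matrix $\Gamma\in\mathcal{D}^d$ and weighted adjacency matrix $Q$ that is extremal Markov to $T$ (i.e. $Q_{uv}=0$ for all distinct $u,v$ with $uv\notin E$), the following are equivalent: (a) (colored tree model) $U_e\stackrel{d}{=}U_{e'}$ whenever $e,e'$ are edges of $T$ with $\lambda(e)=\lambda(e')$; (b) (RCON) $Q_{st}=Q_{uv}$ whenever $st,uv\in E$ and $\lambda(st)=\lambda(uv)$; (c) (RVAR) $\Gamma_{st}=\Gamma_{uv}$ whenever $st,uv\in E$ and $\lambda(st)=\lambda(uv)$.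
   Context: Notation: $[d]=\{1,\dots,d\}$; $\mathbf{1}$ is the all-ones vector; $\mathcal{H}^{d-1}=\{\mathbf{x}\in\mathbb{R}^d:\mathbf{x}^T\mathbf{1}=0\}$; $\mathbb{S}^d_0$ is the space of symmetric real $d\times d$ matrices with zero diagonal; $\mathcal{D}^d=\{\Gamma\in\mathbb{S}^d_0:\mathbf{x}^T\Gamma\mathbf{x}<0\text{ for all }\mathbf{x}\in\mathcal{H}^{d-1}\setminus\{\mathbf{0}\}\}$. To $\Gamma\in\mathcal{D}^d$ associate $P=I_d-\tfrac1d\mathbf{1}\mathbf{1}^T$, $\Sigma=P(-\Gamma/2)P$, and $\Theta=\Sigma^+$ (Moore–Penrose pseudo-inverse), a positive semidefinite matrix with zero row sums. The weighted adjacency matrix $Q\in\mathbb{S}^d_0$ is defined by $Q_{ij}=-\Theta_{ij}$ for $i\ne j$, so $\Theta=D-Q$ with $D$ diagonal, $D_{ii}=\sum_{j\ne i}Q_{ij}$. Hüsler–Reiss vector: for $k\in[d]$ let $\Sigma^{(k)}=\tfrac12(\Gamma_{ik}+\Gamma_{jk}-\Gamma_{ij})_{i,j\ne k}$. The Hüsler–Reiss multivariate Pareto vector $\mathbf{Y}$ with parameter $\Gamma$ is the random vector supported on $\{\mathbf{x}\in\mathbb{R}^d:\max_i x_i>0\}$ such that for every $k$, $\mathbf{Y}\mid\{Y_k>0\}\stackrel{d}{=}E\,\mathbf{1}+\mathbf{W}^k$, where $E$ is standard exponential, independent of $\mathbf{W}^k$, $W^k_k=0$, and $\mathbf{W}^k_{\setminus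 k}$ is Gaussian with mean $-\tfrac12\operatorname{diag}(\Sigma^{(k)})$ and covariance $\Sigma^{(k)}$; $\mathbf{W}^k$ is the $k$-th extremal function. A Hüsler–Reiss vector is extremal Markov to a graph $G=(V,E)$ if and only if $Q_{uv}=0$ for all $uv\notin E$. Tree representation: fix a root $k\in V$ and let $T^k=(V,E^k)$ be $T$ with all edges directed away from $k$. If $\mathbf{Y}$ is extremal Markov to $T$, then $W^k_i=\sum_{e}U_e$ for all $i\ne k$, the sum being over the edges $e$ of the directed path from $k$ to $i$ in $T^k$, where $(U_e)_{e\in E^k}$ are independent; explicitly $U_e=W^k_j-W^k_i$ for $e=(i,j)\in E^k$, and $U_{e}\sim N(-\Gamma_{ij}/2,\Gamma_{ij})$. The color of a directed edge is the color of its undirected version. *)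

(* Defs.v *)
From HB Require Import structures.
From mathcomp Require Import all_boot all_order all_algebra.
From mathcomp Require Import all_classical all_reals all_analysis.

Set Implicit Arguments.
Unset Strict Implicit.
Unset Printing Implicit Defensive.

Import Order.TTheory GRing.Theory Num.Theory.
Import numFieldNormedType.Exports.

Local Open Scope classical_set_scope.
Local Open Scope ring_scope.

Definition tree (V : finType) (e : rel V) : Prop :=
  [/\ symmetric e, irreflexive e, forall u v : V, connect e u v
    & forall c : seq V, ucycle e c -> (size c <= 2)%N].

(* A coloring of the edges is a function on vertex pairs, of which only the
   values at pairs uv with e u v are ever used. *)
Definition uedge (V : finType) (u v : V) : {set V} := [set u; v]%SET.

(* (i, j) is an edge of the tree directed away from the root k: the simple path
   from k to j is k :: rcons p j, and i is its last vertex before j. *)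
Definition dedge (V : finType) (e : rel V) (k i j : V) : Prop :=
  e i j /\ exists p : seq V, [/\ path e k p, last k p = i & uniq (k :: rcons p j)].

Section Matrices.
Variables (R : realType) (d : nat).
Implicit Types G A B : 'M[R]_d.

Definition cnd_variogram G : Prop :=
  [/\ G^T = G, forall i, G i i = 0
    & forall x : 'cV[R]_d,
        (x^T *m const_mx 1 : 'M[R]_1) = 0 -> x != 0 -> (x^T *m G *m x) 0 0 < 0].

Definition moore_penrose A B : Prop :=
  [/\ A *m B *m A = A, B *m A *m B = B,
      (A *m B)^T = A *m B & (B *m A)^T = B *m A].

(* The matrix determined by [moore_penrose A]; see [pinvP] and
   [moore_penrose_uniq]. *)
Definition pinv A : 'M[R]_d := xget 0 [set B | moore_penrose A B].

Definition centering : 'M[R]_d := 1%:M - d%:R^-1 *: const_mx 1.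

Definition HR_Sigma G : 'M[R]_d := centering *m (- (2^-1 *: G)) *m centering.

Definition HR_Theta G : 'M[R]_d := pinv (HR_Sigma G).

Definition HR_adj G : 'M[R]_d :=
  \matrix_(i, j) (if i == j then 0 else - HR_Theta G i j).

(* Rows and columns are indexed by the vertices other than k through
   [lift k : 'I_d.-1 -> 'I_d]. *)
Definition HR_cov G (k : 'I_d) : 'M[R]_d.-1 :=
  \matrix_(i, j) (2^-1 * (G (lift k i) k + G (lift k j) k
                          - G (lift k i) (lift k j))).

Definition HR_mean G (k : 'I_d) : 'rV[R]_d.-1 :=
  \row_i (- (2^-1 * HR_cov G k i i)).

End Matrices.

Lemma moore_penrose_uniq (R : realType) (d : nat) (A B C : 'M[R]_d) :
  moore_penrose A B -> moore_penrose A C -> B = C.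
Proof.
move=> [b1 b2 b3 b4] [c1 c2 c3 c4].
have AB : A *m B = A *m C.
  rewrite -{1}c1 -mulmxA -c3 -b3 -trmx_mul -!mulmxA.
  by rewrite !mulmxA b1.
have BA : B *m A = C *m A.
  rewrite -{1}c1 !mulmxA -mulmxA -c4 -b4 -trmx_mul.
  by rewrite -!mulmxA (mulmxA A B A) b1.
by rewrite -b2 -mulmxA AB mulmxA BA -[LHS]mulmxA mulmxA c2.
Qed.

Lemma gram_unitmx (R : realType) (m n : nat) (B : 'M[R]_(m, n)) :
  row_free B -> B *m B^T \in unitmx.
Proof.
move=> fB; rewrite -row_free_unit; apply/inj_row_free => v vBB.
have /matrixP/(_ 0 0) : v *m B *m (v *m B)^T = 0.
  by rewrite trmx_mul !mulmxA -(mulmxA v) vBB mul0mx.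
rewrite !mxE => /eqP; rewrite psumr_eq0; last first.
  by move=> j _; rewrite [(_^T) _ _]mxE -expr2 sqr_ge0.
move=> /allP h; apply/eqP; rewrite -(mulmx_free_eq0 v fB); apply/eqP/rowP => j.
have := h j (mem_index_enum j); rewrite [(_^T) _ _]mxE mulf_eq0 orbb => /eqP ->.
by rewrite mxE.
Qed.

Lemma moore_penrose_factor (R : realType) (d n : nat) (C : 'M[R]_(d, n))
    (B : 'M[R]_(n, d)) : row_full C -> row_free B ->
  moore_penrose (C *m B)
    (B^T *m invmx (B *m B^T) *m (invmx (C^T *m C) *m C^T)).
Proof.
move=> fC fB; have uB : B *m B^T \in unitmx by exact: gram_unitmx.
have uC : C^T *m C \in unitmx.
  have := @gram_unitmx R _ _ C^T; rewrite trmxK; apply.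
  by rewrite /row_free mxrank_tr.
set GB := invmx (B *m B^T); set GC := invmx (C^T *m C).
have sB : GB^T = GB by rewrite /GB trmx_inv trmx_mul trmxK.
have sC : GC^T = GC by rewrite /GC trmx_inv trmx_mul trmxK.
have BG : B *m B^T *m GB = 1%:M by exact: mulmxV.
have GG : GC *m (C^T *m C) = 1%:M by exact: mulVmx.
set X := (X in moore_penrose _ X).
have AX : C *m B *m X = C *m GC *m C^T.
  by rewrite /X !mulmxA -(mulmxA C B) -(mulmxA C _ GB) BG mulmx1.
have XA : X *m (C *m B) = B^T *m GB *m B.
  by rewrite /X -!mulmxA (mulmxA C^T) (mulmxA GC) GG mul1mx.
split.
- by rewrite AX -!mulmxA (mulmxA C^T) (mulmxA GC) GG mul1mx.
- rewrite XA /X -!mulmxA; congr (_ *m (_ *m _)).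
  by rewrite !mulmxA BG mul1mx.
- by rewrite AX !trmx_mul trmxK sC mulmxA.
- by rewrite XA !trmx_mul trmxK sB mulmxA.
Qed.

Lemma pinvP (R : realType) (d : nat) (A : 'M[R]_d) : moore_penrose A (pinv A).
Proof.
rewrite /pinv; case: xgetP => [B -> //|none].
have := moore_penrose_factor (col_base_full A) (row_base_free A).
by rewrite mulmx_base => /none.
Qed.

Section Laws.
Context (R : realType).
Local Open Scope ereal_scope.

Definition same_law d1 d2 d3 (T1 : measurableType d1) (T2 : measurableType d2)
    (S : measurableType d3) (P1 : probability T1 R) (X1 : T1 -> S)
    (P2 : probability T2 R) (X2 : T2 -> S) : Prop :=
  forall A : set S, measurable A -> pushforward P1 X1 A = pushforward P2 X2 A.

Definition cond_prob d1 (T : measurableType d1) (P : probability T R)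
    (B A : set T) : \bar R := P (A `&` B) / P B.

Definition independent_RV d1 d2 d3 (T : measurableType d1)
    (S1 : measurableType d2) (S2 : measurableType d3) (P : probability T R)
    (X1 : T -> S1) (X2 : T -> S2) : Prop :=
  forall (A1 : set S1) (A2 : set S2), measurable A1 -> measurable A2 ->
    P (X1 @^-1` A1 `&` X2 @^-1` A2) = P (X1 @^-1` A1) * P (X2 @^-1` A2).

(* N(m, v), v being the variance; [normal_prob] takes the standard deviation and
   does not give the Dirac mass when it is 0. *)
Definition gauss_law (m v : R) : set R -> \bar R :=
  if v == 0%R then dirac m else normal_prob m (Num.sqrt v).

(* X ~ N(m, S), possibly degenerate: each linear combination of the coordinates
   of X is Gaussian, with the mean and variance prescribed by m and S. *)
Definition gaussian_vector d1 (T : measurableType d1) (P : probability T R)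
    (n : nat) (X : T -> n.-tuple R) (m : 'rV[R]_n) (S : 'M[R]_n) : Prop :=
  [/\ S^T = S,
      forall a : 'rV[R]_n, (0 <= (a *m S *m a^T) 0 0)%R
    & forall (a : 'rV[R]_n) (A : set R), measurable A ->
        pushforward P (fun w => \sum_(i < n) (a 0 i * tnth (X w) i))%R A =
        gauss_law ((a *m m^T) 0 0)%R ((a *m S *m a^T) 0 0)%R A].

Variable d : nat.

(* W is a version of the k-th extremal function W^k of Y; it need not be defined
   on the same probability space as Y. *)
Definition extremal_function d1 d2 (T : measurableType d1)
    (T' : measurableType d2) (P : probability T R) (P' : probability T' R)
    (G : 'M[R]_d) (Y : {RV P >-> d.-tuple R}) (k : 'I_d)
    (W : {RV P' >-> d.-tuple R}) : Prop :=
  [/\ 0 < P [set w | (0 < tnth (Y w) k)%R],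
      exists E : {RV P' >-> R},
        [/\ forall A : set R, measurable A ->
              distribution P' E A = exponential_prob 1%R A,
            independent_RV P' E W
          & forall A : set (d.-tuple R), measurable A ->
              cond_prob P [set w | (0 < tnth (Y w) k)%R] (Y @^-1` A) =
              pushforward P'
                (fun w => [tuple (E w + tnth (W w) i)%R | i < d]) A],
      {ae P', forall w, tnth (W w) k = 0%R}
    & gaussian_vector P' (fun w => [tuple tnth (W w) (lift k i) | i < d.-1])
        (HR_mean G k) (HR_cov G k)].

Definition husler_reiss d1 (T : measurableType d1) (P : probability T R)
    (G : 'M[R]_d) (Y : {RV P >-> d.-tuple R}) : Prop :=
  {ae P, forall w, exists i, (0 < tnth (Y w) i)%R} /\
  forall k : 'I_d, exists (d2 : measure_display) (T' : measurableType d2)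
    (P' : probability T' R) (W : {RV P' >-> d.-tuple R}),
    extremal_function G Y k W.

End Laws.

Section Models.
Variables (R : realType) (d r : nat) (e : rel 'I_d) (lam : {set 'I_d} -> 'I_r).

(* For a Hüsler–Reiss vector with parameter G, this is equivalent to extremal
   conditional independence with respect to the graph. *)
Definition extremal_markov (G : 'M[R]_d) : Prop :=
  forall u v : 'I_d, u != v -> ~~ e u v -> HR_adj G u v = 0.

Definition increment d1 (T : measurableType d1) (P : probability T R)
    (W : {RV P >-> d.-tuple R}) (i j : 'I_d) : T -> R :=
  fun w => tnth (W w) j - tnth (W w) i.

(* W is the k-th extremal function, k being the root. *)
Definition colored_tree_model d1 (T : measurableType d1) (P : probability T R)
    (k : 'I_d) (W : {RV P >-> d.-tuple R}) : Prop :=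
  forall i j s t : 'I_d, dedge e k i j -> dedge e k s t ->
    lam (uedge i j) = lam (uedge s t) ->
    same_law P (increment W i j) P (increment W s t).

Definition RCON_model (G : 'M[R]_d) : Prop :=
  forall s t u v : 'I_d, e s t -> e u v ->
    lam (uedge s t) = lam (uedge u v) -> HR_adj G s t = HR_adj G u v.

Definition RVAR_model (G : 'M[R]_d) : Prop :=
  forall s t u v : 'I_d, e s t -> e u v ->
    lam (uedge s t) = lam (uedge u v) -> G s t = G u v.

End Models.

(* Main.v *)
(* Removing an edge uv cuts the tree in two; let S be the side of u. Since uv is
   the only edge leaving S, the Laplacian Theta maps the indicator of S to
   Q_uv (e_u - e_v). As Sigma Theta is the centering projection, pairing
   Sigma Theta 1_S with e_a - e_b gives
     Q_uv (- 1/2) (G_au - G_av - G_bu + G_bv) = 1_S(a) - 1_S(b).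
   For (a, b) = (u, v) this says Q_uv = 1 / G_uv, hence RCON <-> RVAR. For
   (a, b) = (u, k), with k the root and u on its side of the edge, it says that
   G_kv = G_ku + G_uv; so the increment of W^k along uv, which is Gaussian with
   variance G_uv, has mean - G_uv / 2, and its law and G_uv determine each
   other. *)
Require Import Defs.
From mathcomp Require Import all_boot all_order all_algebra.
From mathcomp Require Import all_classical all_reals all_analysis.
From mathcomp Require Import ring lra.

Set Implicit Arguments.
Unset Strict Implicit.
Unset Printing Implicit Defensive.

Import Order.TTheory GRing.Theory Num.Theory.
Import numFieldNormedType.Exports.

Local Open Scope classical_set_scope.
Local Open Scope ring_scope.

(** * Cutting a tree at an edge, and orienting its edges away from a root *)

Section TreeCut.
Variables (V : finType) (e : rel V).
Implicit Types (u v k : V) (p : seq V).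

(** Both orientations are deleted, so the relation stays symmetric when [e] is; [branch_root]
    reverses a path thanks to this. *)
Definition remove_edge u v : rel V :=
  [rel x y | e x y && ~~ ((x == u) && (y == v) || (x == v) && (y == u))].

Definition branch u v : {set V} := [set w | connect (remove_edge u v) u w]%SET.

Lemma branch_self u v : u \in branch u v.
Proof. by rewrite inE connect0. Qed.

(** A simple path from [u] to [v] avoiding the edge would close up with it into a cycle. The bound 2
    on cycles leaves only the empty path, excluded by irreflexivity, and the single step [u], [v],
    which was removed. *)
Lemma branch_other u v : tree e -> e u v -> v \notin branch u v.
Proof.
move=> [esym eirr _ ecyc] euv; rewrite inE; apply/negP => /connectP[p pth vE].
case/shortenP: pth vE => {}p pth up _ vE.
have pe : path e u p.
  by apply: sub_path pth => x y /andP[].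
have := ecyc (u :: p); rewrite /ucycle /= rcons_path pe -vE esym euv /=.
move=> /(_ up); case: p pth {up pe} vE => [_ /= vu|w [|//] /= + vw _].
  by rewrite vu eirr in euv.
by rewrite -vw /remove_edge /= !eqxx andbF.
Qed.

Lemma branch_cut u v i j : tree e -> e u v ->
  i \in branch u v -> j \notin branch u v -> e i j -> i = u /\ j = v.
Proof.
move=> te euv iS jS eij; have vS := branch_other te euv.
case: (boolP (remove_edge u v i j)) => [rij|].
  case/negP: jS; move: iS; rewrite !inE => iS.
  exact: connect_trans iS (connect1 rij).
rewrite /remove_edge /= eij /= negbK => /orP[] /andP[/eqP iE /eqP jE] //.
by rewrite iE (negbTE vS) in iS.
Qed.

(** The simple path from [k] to [u] never meets [v], so it survives the removal of the edge. *)
Lemma branch_root k u v : tree e -> dedge e k u v -> k \in branch u v.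
Proof.
move=> [esym _ _ _] [euv [p [pth lp]]].
rewrite -rcons_cons rcons_uniq => /andP[vp _].
rewrite inE sym_connect_sym; last first.
  by move=> x y; rewrite /remove_edge /= esym orbC ![(_ == u) && _]andbC
    ![(_ == v) && _]andbC.
rewrite -{}lp {euv}; apply/connectP; exists p => //.
move: (last k p) => w; elim: p k pth vp => //= y p IHp x /andP[exy pth].
rewrite !inE !negb_or => /and3P[vx vy vp].
rewrite /remove_edge /= exy IHp ?inE ?negb_or ?vy //= andbT.
by rewrite ![_ == v]eq_sym (negbTE vx) (negbTE vy) andbF.
Qed.

(** Take a simple path from [k] to [s]. If it misses [t], it extends to [t]; otherwise its initial
    segment ending at [t] misses [s] and extends to [s]. *)
Lemma edge_dedge k s t : tree e -> e s t -> dedge e k s t \/ dedge e k t s.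
Proof.
move=> [esym eirr econ _] est; have /connectP[p pth sE] := econ k s.
case/shortenP: pth sE => {}p pth up _ sE.
have [tp|tp] := boolP (t \in k :: p); last first.
  by left; split=> //; exists p; split; rewrite // -rcons_cons rcons_uniq tp.
right; split; first by rewrite esym.
case/splitPl: tp pth up sE => p1 p2 tE.
rewrite cat_path last_cat tE -cat_cons cat_uniq.
move=> /andP[pth _] /and3P[up1 dis _] sE.
exists p1; split=> //; rewrite -rcons_cons rcons_uniq up1 andbT.
apply: contra dis => sp1; apply/hasP; exists s => //.
case: p2 sE => [/= ts|w p2 ->]; first by rewrite ts eirr in est.
by rewrite /= mem_last.
Qed.

End TreeCut.

(** * Algebra of the variogram, [HR_Sigma] and its pseudo-inverse *)

Section HuslerReissMatrices.
Variables (R : realType) (d : nat) (G : 'M[R]_d).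
Hypotheses (d_gt0 : (0 < d)%N) (hG : cnd_variogram G).

Lemma variogram_sym i j : G i j = G j i.
Proof. by case: hG => /matrixP/(_ j i); rewrite mxE. Qed.

Lemma variogram_diag i : G i i = 0.
Proof. by case: hG. Qed.

Lemma mulmx_deltaB (m n : nat) (a b : 'I_m) (A : 'M[R]_(m, n)) (u v : 'I_n) :
  ((delta_mx 0 a - delta_mx 0 b : 'rV_m) *m A *m
     (delta_mx u 0 - delta_mx v 0 : 'cV_n)) 0 0 =
  A a u - A a v - A b u + A b v.
Proof.
by rewrite mulmxBl mulmxBr -!rowE -!colE !mxE; ring.
Qed.

Lemma deltaB_const (a b : 'I_d) n :
  (delta_mx 0 a - delta_mx 0 b : 'rV[R]_d) *m const_mx 1 = 0 :> 'rV_n.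
Proof. by apply/rowP => j; rewrite mulmxBl -!rowE !mxE subrr. Qed.

Lemma const_deltaB (u v : 'I_d) n :
  const_mx 1 *m (delta_mx u 0 - delta_mx v 0 : 'cV[R]_d) = 0 :> 'cV_n.
Proof. by apply/colP => j; rewrite mulmxBr -!colE !mxE subrr. Qed.

Lemma variogram_gt0 i j : i != j -> 0 < G i j.
Proof.
move=> ij; case: hG => _ _ /(_ (delta_mx i 0 - delta_mx j 0)).
rewrite linearB /= !trmx_delta deltaB_const mulmx_deltaB !variogram_diag.
(* The quadratic form at e_i - e_j equals -2 G_ij. *)
rewrite (variogram_sym j i) => /(_ erefl) h.
suff : 0 - G i j - G i j + 0 < 0 by lra.
apply: h; apply/eqP => /matrixP/(_ i 0); rewrite !mxE !eqxx (negbTE ij) /= => /eqP.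
by rewrite subr0 oner_eq0.
Qed.

Lemma trmx_centering : (centering R d)^T = centering R d.
Proof. by rewrite /centering linearB /= trmx1 linearZ /= trmx_const. Qed.

Lemma centering_const n : centering R d *m const_mx 1 = 0 :> 'M[R]_(d, n).
Proof.
apply/matrixP => i j; rewrite mulmxBl mul1mx -scalemxAl !mxE.
under eq_bigr do rewrite !mxE mulr1.
by rewrite sumr_const card_ord mulVf ?subrr // pnatr_eq0 -lt0n.
Qed.

Lemma const_centering n : const_mx 1 *m centering R d = 0 :> 'M[R]_(n, d).
Proof.
by rewrite -[LHS]trmxK trmx_mul trmx_const trmx_centering centering_const trmx0.
Qed.

Lemma mulmx_centering n (A : 'M[R]_(n, d)) :
  A *m (const_mx 1 : 'M[R]_d) = 0 -> A *m centering R d = A.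
Proof. by move=> A0; rewrite mulmxBr mulmx1 -scalemxAr A0 scaler0 subr0. Qed.

Lemma centering_mulmx n (A : 'M[R]_(d, n)) :
  (const_mx 1 : 'M[R]_d) *m A = 0 -> centering R d *m A = A.
Proof. by move=> A0; rewrite mulmxBl mul1mx -scalemxAl A0 scaler0 subr0. Qed.

Lemma trmx_HR_Sigma : (HR_Sigma G)^T = HR_Sigma G.
Proof.
case: hG => GT _ _.
by rewrite /HR_Sigma !trmx_mul trmx_centering linearN linearZ /= GT !mulmxA.
Qed.

Lemma HR_Sigma_const n : HR_Sigma G *m const_mx 1 = 0 :> 'M[R]_(d, n).
Proof. by rewrite /HR_Sigma -mulmxA centering_const mulmx0. Qed.

Lemma HR_Sigma_centering : HR_Sigma G *m centering R d = HR_Sigma G.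
Proof. by rewrite mulmx_centering ?HR_Sigma_const. Qed.

(** Differences of basis vectors are orthogonal to 1, so both centering factors act on them as the
    identity. *)
Lemma HR_Sigma_deltaB (a b u v : 'I_d) :
  ((delta_mx 0 a - delta_mx 0 b : 'rV_d) *m HR_Sigma G *m
     (delta_mx u 0 - delta_mx v 0 : 'cV_d)) 0 0 =
  - 2^-1 * (G a u - G a v - G b u + G b v).
Proof.
rewrite /HR_Sigma !mulmxA (mulmx_centering (deltaB_const a b d)).
rewrite -(mulmxA _ (centering R d)) (centering_mulmx (const_deltaB u v d)).
by rewrite mulmx_deltaB !mxE; ring.
Qed.

(* On the hyperplane orthogonal to 1 the form of [HR_Sigma G] is - G / 2, which
   is definite there. *)
Lemma HR_Sigma_inj n (A : 'M[R]_(d, n)) :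
  HR_Sigma G *m A = 0 -> (const_mx 1 : 'M[R]_d) *m A = 0 -> A = 0.
Proof.
move=> SA JA; apply/matrixP => i j; rewrite mxE.
suff /colP/(_ i) : col j A = 0 by rewrite !mxE.
apply/eqP/negPn/negP => y0; set y := col j A in y0.
have Jy : (const_mx 1 : 'M[R]_d) *m y = 0.
  by rewrite /y colE mulmxA JA mul0mx.
have Sy : HR_Sigma G *m y = 0 by rewrite /y colE mulmxA SA mul0mx.
have Py : centering R d *m y = y by exact: centering_mulmx.
case: hG => _ _ /(_ y); apply/not_implyP; split.
  by rewrite -Py trmx_mul trmx_centering -mulmxA centering_const mulmx0.
move=> /(_ y0); have : y^T *m HR_Sigma G *m y = 0 by rewrite -mulmxA Sy mulmx0.
have yP : y^T *m centering R d = y^T by rewrite -{2}Py trmx_mul trmx_centering.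
rewrite /HR_Sigma !mulmxA yP -(mulmxA _ _ y) Py mulmxN mulNmx.
rewrite -scalemxAr -scalemxAl.
by move=> /matrixP/(_ 0 0); rewrite !mxE; lra.
Qed.

(** [HR_Sigma_inj] applies to the difference of the two sides: the first Penrose identity shows that
    [HR_Sigma G] kills it, and the symmetry of the product that the all-ones matrix does. *)
Lemma HR_Theta_Sigma : HR_Theta G *m HR_Sigma G = centering R d.
Proof.
have [STS _ _ TS] := pinvP (HR_Sigma G); rewrite -/(HR_Theta G) in STS TS.
apply/eqP; rewrite -subr_eq0; apply/eqP/HR_Sigma_inj.
  by rewrite mulmxBr mulmxA STS HR_Sigma_centering subrr.
rewrite mulmxBr const_centering subr0 -TS trmx_mul trmx_HR_Sigma mulmxA.
by rewrite /HR_Sigma !mulmxA const_centering !mul0mx.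
Qed.

(** The transpose is again a Moore-Penrose inverse of the symmetric [HR_Sigma G], and that inverse
    is unique. *)
Lemma trmx_HR_Theta : (HR_Theta G)^T = HR_Theta G.
Proof.
have [h1 h2 h3 h4] := pinvP (HR_Sigma G); rewrite -/(HR_Theta G) in h1 h2 h3 h4.
apply: (@moore_penrose_uniq _ _ (HR_Sigma G)); last exact: pinvP.
have TS : (HR_Theta G)^T *m HR_Sigma G = HR_Sigma G *m HR_Theta G.
  by rewrite -h3 trmx_mul trmx_HR_Sigma.
have ST : HR_Sigma G *m (HR_Theta G)^T = HR_Theta G *m HR_Sigma G.
  by rewrite -h4 trmx_mul trmx_HR_Sigma.
split.
- have := congr1 trmx h1.
  by rewrite trmx_mul trmx_HR_Sigma trmx_mul trmx_HR_Sigma mulmxA.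
- have := congr1 trmx h2.
  by rewrite trmx_mul (trmx_mul (HR_Theta G)) trmx_HR_Sigma mulmxA.
- by rewrite ST h4.
- by rewrite TS h3.
Qed.

Lemma HR_Sigma_Theta : HR_Sigma G *m HR_Theta G = centering R d.
Proof.
by rewrite -trmx_centering -HR_Theta_Sigma trmx_mul trmx_HR_Sigma trmx_HR_Theta.
Qed.

Lemma HR_Theta_const : HR_Theta G *m const_mx 1 = 0 :> 'cV_d.
Proof.
have [_ h _ _] := pinvP (HR_Sigma G); rewrite -/(HR_Theta G) in h.
by rewrite -h -(mulmxA (HR_Theta G)) HR_Sigma_Theta -mulmxA
  centering_const mulmx0.
Qed.

(** * Consequences of the Markov property on a tree *)

Section Tree.
Variable e : rel 'I_d.
Hypotheses (te : tree e) (hM : extremal_markov e G).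

(** Between the branch and its complement, the only nonzero entries of [HR_Theta G] can be those at
    (u, v) and (v, u). *)
Lemma HR_Theta_branch u v : e u v ->
  HR_Theta G *m (\col_i (i \in branch e u v)%:R) =
  HR_adj G u v *: (delta_mx u 0 - delta_mx v 0 : 'cV_d).
Proof.
move=> euv; set S := branch e u v; set q := HR_adj G u v.
have uS : u \in S by exact: branch_self.
have vS : v \notin S by exact: branch_other.
have thE i j : i \in S -> j \notin S ->
    HR_Theta G i j = - (q * (i == u)%:R * (j == v)%:R).
  move=> iS jS; have ij : i != j by apply: contraNneq jS => <-.
  have -> : HR_Theta G i j = - HR_adj G i j by rewrite mxE (negbTE ij) opprK.
  congr (- _); have [eij|neij] := boolP (e i j).
    by have [-> ->] := branch_cut te euv iS jS eij; rewrite !eqxx !mulr1.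
  rewrite (hM ij neij); have [iu|] := eqVneq i u; last by rewrite mulr0 mul0r.
  have [jv|] := eqVneq j v; last by rewrite mulr0.
  by rewrite iu jv euv in neij.
apply/colP => i; rewrite !mxE eqxx !andbT.
under eq_bigr do rewrite mxE mulr_natr mulrb; rewrite -big_mkcond /=.
have [iS|iS] := boolP (i \in S).
  (* For a row inside the branch, zero row sums replace the sum over the branch by minus the sum
     over its complement, where only column [v] can contribute. *)
  have : \sum_j HR_Theta G i j = 0.
    have /colP/(_ i) := HR_Theta_const; rewrite !mxE => h.
    by rewrite -[RHS]h; apply: eq_bigr => j _; rewrite mxE mulr1.
  rewrite (bigID (mem S)) /= => /eqP; rewrite addr_eq0 => /eqP ->.
  rewrite -sumrN (bigD1 v) //= big1 ?addr0.
    rewrite thE // opprK eqxx mulr1; suff -> : (i == v) = false by rewrite subr0.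
    by apply: contraNF vS => /eqP <-.
  by move=> j /andP[jS jv]; rewrite thE // (negbTE jv) mulr0 !oppr0.
have -> : (i == u) = false by apply: contraNF iS => /eqP ->.
rewrite sub0r; have thT j : HR_Theta G i j = HR_Theta G j i.
  by rewrite -{1}trmx_HR_Theta mxE.
rewrite (bigD1 u) //= big1 ?addr0.
  by rewrite thT thE // eqxx mulr1 mulrN.
by move=> j /andP[jS ju]; rewrite thT thE // (negbTE ju) mulr0 mul0r oppr0.
Qed.

Lemma branch_variogram u v a b : e u v ->
  HR_adj G u v * (- 2^-1 * (G a u - G a v - G b u + G b v)) =
  (a \in branch e u v)%:R - (b \in branch e u v)%:R.
Proof.
move=> euv; rewrite -HR_Sigma_deltaB.
have := congr1 (mulmx ((delta_mx 0 a - delta_mx 0 b : 'rV_d) *m HR_Sigma G))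
  (HR_Theta_branch euv).
rewrite -scalemxAr (mulmxA _ (HR_Theta G)) -(mulmxA _ (HR_Sigma G) (HR_Theta G)).
rewrite HR_Sigma_Theta.
rewrite (mulmx_centering (deltaB_const a b d)) mulmxBl -!rowE.
by move=> /matrixP/(_ 0 0); rewrite !mxE.
Qed.

Lemma HR_adj_variogram u v : e u v -> HR_adj G u v * G u v = 1.
Proof.
move=> euv; have := branch_variogram u v euv.
rewrite branch_self (negbTE (branch_other te euv)) !variogram_diag.
by rewrite (variogram_sym v u) subr0 => h; rewrite -[RHS]h; congr (_ * _); lra.
Qed.

Lemma HR_adj_edge u v : e u v -> HR_adj G u v = (G u v)^-1.
Proof.
move=> /HR_adj_variogram h; suff G0 : G u v != 0.
  by apply: (mulIf G0); rewrite h mulVf.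
by apply: contra_eq_neq h => ->; rewrite mulr0 eq_sym oner_neq0.
Qed.

Lemma variogram_dedge k u v : dedge e k u v -> G v k = G u k + G u v.
Proof.
move=> kuv; have [euv _] := kuv; have := branch_variogram u k euv.
rewrite branch_self (branch_root te kuv) subrr variogram_diag.
(* [u] and [k] lie on the same side, so the product vanishes; its factor Q_uv does not, since Q_uv
   G_uv = 1. *)
have /eqP := HR_adj_variogram euv; have [->|q0 _] := eqVneq (HR_adj G u v) 0.
  by rewrite mul0r eq_sym oner_eq0.
move=> /eqP; rewrite mulf_eq0 (negbTE q0) /= => /eqP.
by rewrite (variogram_sym k u) (variogram_sym k v); lra.
Qed.

Lemma RCON_RVAR r (lam : {set 'I_d} -> 'I_r) :
  RCON_model e lam G <-> RVAR_model e lam G.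
Proof.
split=> h s t u v est euv l; have := h s t u v est euv l.
  by rewrite !HR_adj_edge // => /invr_inj.
by rewrite !HR_adj_edge // => ->.
Qed.

End Tree.

End HuslerReissMatrices.

(** * Gaussian laws determine their variance; laws of almost surely equal maps *)

Section GaussianLaws.
Variable R : realType.

(* The density is the derivative of the distribution function, and it is bounded
   by its value at the mean, which determines the variance. *)
Lemma normal_prob_sd_inj (m1 m2 s1 s2 : R) : 0 < s1 -> 0 < s2 ->
  (forall A : set R, measurable A -> normal_prob m1 s1 A = normal_prob m2 s2 A) ->
  s1 = s2.
Proof.
move=> s10 s20 eqN; have n1 := lt0r_neq0 s10; have n2 := lt0r_neq0 s20.
have pdfE x : normal_pdf m1 s1 x = normal_pdf m2 s2 x.
  have cdf (m s : R) : s != 0 ->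
      derive1 (fun y : R => fine (normal_prob m s `]-oo, y])) x =
      normal_pdf m s x.
    (* Any upper endpoint beyond [x] would do. *)
    move=> s0; apply: (continuous_FTC1 (u := x + 1) _ _ _ _).2 => //.
    - by rewrite ltrDl.
    - by apply: integrableS (integrable_normal_pdf m s).
    - exact: ltNyr.
    - exact: continuous_normal_pdf.
  apply: etrans (esym (cdf m1 s1 n1)) (etrans _ (cdf m2 s2 n2)).
  apply: (congr1 (fun F => derive1 F x)); apply/funext => y.
  by congr fine; apply: eqN.
have peak (m s : R) : s != 0 -> normal_pdf m s m = normal_peak s.
  by move=> s0; rewrite normal_pdfE // /normal_fun subrr expr0n oppr0 mul0r expR0
    mulr1.
have : normal_peak s1 = normal_peak s2.
  apply/eqP; rewrite eq_le; apply/andP; split.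
    by rewrite -(peak m1) // pdfE normal_pdf_ub.
  by rewrite -(peak m2) // -pdfE normal_pdf_ub.
have pi0 : 0 < pi :> R by exact: pi_gt0.
(* The peak is the inverse of the square root of 2 pi s^2, which is injective in s > 0. *)
move=> /invr_inj/eqP; rewrite eqr_sqrt ?mulrn_wge0 ?mulr_ge0 ?sqr_ge0 ?ltW //.
rewrite eqrMn2r /= (inj_eq (mulIf (lt0r_neq0 pi0))).
by rewrite eqrXn2 ?ltW // => /eqP.
Qed.

Lemma gauss_law_var_inj (m1 m2 v1 v2 : R) : 0 < v1 -> 0 < v2 ->
  (forall A : set R, measurable A -> gauss_law m1 v1 A = gauss_law m2 v2 A) ->
  v1 = v2.
Proof.
move=> v10 v20; rewrite /gauss_law !gt_eqF // => /normal_prob_sd_inj h.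
by apply/eqP; rewrite -eqr_sqrt ?ltW // h ?sqrtr_gt0.
Qed.

(** By symmetry one inequality suffices: the preimage under [f] lies in the preimage under [g]
    enlarged by a null set. *)
Lemma pushforward_ae d1 d2 (T : measurableType d1) (S : measurableType d2)
    (mu : {measure set T -> \bar R}) (f g : T -> S) (A : set S) :
  measurable_fun setT f -> measurable_fun setT g ->
  {ae mu, forall w, f w = g w} -> measurable A ->
  pushforward mu f A = pushforward mu g A.
Proof.
wlog suff le : f g / measurable_fun setT f -> measurable_fun setT g ->
    {ae mu, forall w, f w = g w} -> measurable A ->
    (pushforward mu f A <= pushforward mu g A)%E.
  move=> mf mg fg mA; apply/eqP; rewrite eq_le !le //.
  by apply: filterS fg.
move=> mf mg [N [mN N0 fgN]] mA; rewrite /pushforward.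
have mfA : measurable (f @^-1` A) by rewrite -[X in measurable X]setTI; exact: mf.
have mgA : measurable (g @^-1` A) by rewrite -[X in measurable X]setTI; exact: mg.
rewrite -[leRHS]adde0 -N0; apply: le_trans (measureU2 _ _ _) => //.
apply: le_measure; rewrite ?inE //; first exact: measurableU.
move=> w /= Afw; have [fgw|fgw] := pselect (f w = g w).
  by left; rewrite /= -fgw.
by right; apply: fgN.
Qed.

End GaussianLaws.

(** * Laws of the increments of an extremal function *)

Section Increments.
Variables (R : realType) (d : nat) (G : 'M[R]_d) (k : 'I_d).
Hypothesis hG : cnd_variogram G.

(** This writes a difference as a linear combination over the indices other than [k], including when
    [i] or [j] is [k]. It serves for the mean, the variance and the increment itself. *)
Lemma sum_lift_diff (i j : 'I_d) (F : 'I_d -> R) : F k = 0 ->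
  \sum_(x < d.-1) ((lift k x == j)%:R - (lift k x == i)%:R) * F (lift k x) =
  F j - F i.
Proof.
move=> Fk.
transitivity (\sum_y ((y == j)%:R - (y == i)%:R) * F y).
  by rewrite [RHS](bigD1_ord k) //= Fk mulr0 add0r.
have one z : \sum_y (y == z)%:R * F y = F z.
  rewrite (bigD1 z) //= eqxx mul1r big1 ?addr0 // => y /negbTE ->.
  by rewrite mul0r.
by rewrite -(one j) -(one i) -sumrB; apply: eq_bigr => y _; rewrite mulrBl.
Qed.

Variables (d2 : measure_display) (T : measurableType d2) (P : probability T R).
Variable W : {RV P >-> d.-tuple R}.
Hypothesis Wk : {ae P, forall w, tnth (W w) k = 0}.
Hypothesis gW : gaussian_vector P
  (fun w => [tuple tnth (W w) (lift k i) | i < d.-1]) (HR_mean G k) (HR_cov G k).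

Lemma measurable_tnth_RV i : measurable_fun setT (fun w => tnth (W w) i).
Proof. by apply: (measurableT_comp (measurable_tnth i)). Qed.

Lemma increment_law i j A : measurable A ->
  pushforward P (increment W i j) A =
  gauss_law (2^-1 * (G i k - G j k)) (G i j) A.
Proof.
move=> mA; have Gk := variogram_diag hG.
have [_ _ /(_ (\row_x ((lift k x == j)%:R - (lift k x == i)%:R)) _ mA)] := gW.
have -> : ((\row_x ((lift k x == j)%:R - (lift k x == i)%:R)) *m
    (HR_mean G k)^T) 0 0 = 2^-1 * (G i k - G j k).
  rewrite mxE; under eq_bigr do rewrite !mxE.
  rewrite (sum_lift_diff i j (F := fun y =>
     - (2^-1 * (2^-1 * (G y k + G y k - G y y))))) !Gk ?subr0 ?addr0 ?mulr0 ?oppr0 //.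
  by lra.
set a := \row_x _.
have -> : (a *m HR_cov G k *m a^T) 0 0 = G i j.
  (* [F] extends [HR_cov G k] by zero to row and column [k]; the variance is then F_jj - F_ij - F_ji
     + F_ii. *)
  pose F y z := 2^-1 * (G y k + G z k - G y z).
  have row z : (a *m HR_cov G k) 0 z = F j (lift k z) - F i (lift k z).
    rewrite -(sum_lift_diff i j (F := F^~ (lift k z))); last first.
      by rewrite /F Gk (variogram_sym hG k) add0r subrr mulr0.
    by rewrite mxE; apply: eq_bigr => x _; rewrite !mxE.
  transitivity ((F j j - F i j) - (F j i - F i i)); last first.
    by rewrite /F !Gk (variogram_sym hG j i); lra.
  rewrite -(sum_lift_diff i j (F := fun z => F j z - F i z)); last first.
    by rewrite /F Gk; lra.
  by rewrite mxE; apply: eq_bigr => z _; rewrite row !mxE mulrC.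
move=> <-; apply: pushforward_ae => //.
- by apply: measurable_realfun.measurable_funB; exact: measurable_tnth_RV.
- apply: measurable_sum => x; apply: measurable_realfun.measurable_funM => //.
  by under eq_fun do rewrite tnth_mktuple; exact: measurable_tnth_RV.
(* The Gaussian vector omits coordinate [k], so the two maps agree only where W_k = 0, that is,
   almost surely. *)
- apply: filterS Wk => w wk; rewrite /increment.
  rewrite -(sum_lift_diff i j (F := fun y => tnth (W w) y)) //.
  by apply: eq_bigr => x _; rewrite tnth_mktuple mxE.
Qed.

End Increments.

Theorem proposition4p5 (R : realType) (d r : nat) (hd : (2 <= d)%N)
  (e : rel 'I_d) (he : tree e) (lam : {set 'I_d} -> 'I_r)
  (G : 'M[R]_d) (hG : cnd_variogram G)
  (d1 : measure_display) (T : measurableType d1) (P : probability T R)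
  (Y : {RV P >-> d.-tuple R}) (hY : husler_reiss G Y)
  (hM : extremal_markov e G)
  (k : 'I_d)
  (d2 : measure_display) (T' : measurableType d2) (P' : probability T' R)
  (W : {RV P' >-> d.-tuple R}) (hW : extremal_function G Y k W) :
  (colored_tree_model e lam k W <-> RCON_model e lam G) /\
  (RCON_model e lam G <-> RVAR_model e lam G).
Proof.
have d0 : (0 < d)%N by exact: ltnW.
(* It remains to compare the colored tree model with RVAR. *)
have con_var := RCON_RVAR d0 hG he hM lam; split=> //; rewrite con_var.
have [_ _ Wk gW] := hW.
have lawE i j A : dedge e k i j -> measurable A ->
    pushforward P' (increment W i j) A = gauss_law (- (2^-1 * G i j)) (G i j) A.
  move=> kij mA; have := increment_law hG Wk gW i j mA.
  have -> : 2^-1 * (G i k - G j k) = - (2^-1 * G i j).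
    by rewrite (variogram_dedge d0 hG he hM kij); lra.
  exact.
split=> [tm|rv] i j s t; last first.
  move=> kij kst l A mA.
  have Gij : G i j = G s t by apply: rv => //; [case: kij|case: kst].
  apply: etrans (lawE _ _ _ kij mA) (etrans _ (esym (lawE _ _ _ kst mA))).
  by rewrite Gij.
have Gpos u v : dedge e k u v -> 0 < G u v.
  move=> [euv _]; apply: variogram_gt0 => //.
  by case: he => _ eirr _ _; apply: contraTneq euv => ->; rewrite eirr.
have dG u v u' v' : dedge e k u v -> dedge e k u' v' ->
    lam (uedge u v) = lam (uedge u' v') -> G u v = G u' v'.
  move=> kuv kuv' l; apply: gauss_law_var_inj (Gpos _ _ kuv) (Gpos _ _ kuv') _.
  move=> A mA; apply: etrans (esym (lawE _ _ _ kuv mA)) _.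
  exact: etrans (tm _ _ _ _ kuv kuv' l A mA) (lawE _ _ _ kuv' mA).
have uC (u v : 'I_d) : uedge u v = uedge v u by rewrite /uedge finset.setUC.
move=> eij est l.
(* RVAR ranges over both orientations of an edge, the tree model over the one leading away from the
   root; symmetry of [G] and of [uedge] bridges the gap. *)
have [kij|kji] := edge_dedge k he eij; have [kst|kts] := edge_dedge k he est.
- exact: dG.
- by rewrite (variogram_sym hG s); apply: dG; rewrite // [uedge t s]uC.
- by rewrite (variogram_sym hG i); apply: dG; rewrite // [uedge j i]uC.
- rewrite (variogram_sym hG i) (variogram_sym hG s); apply: dG => //.
  by rewrite [uedge j i]uC [uedge t s]uC.
Qed.
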